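(* For every real $\beta>1$ and every positive integer $n$, the $\beta$-shift $X_\beta$ satisfies $|F_{X_\beta}(n)|\le n+1$.
   Context: Let $\beta>1$ be real. For $x\in[0,1)$, $d_\beta(x)=.x_1x_2x_3\ldots$ is the lexicographically largest sequence over $\{0,1,\ldots,\lfloor\beta\rfloor\}$ with $x=\sum_{n\ge1}x_n\beta^{-n}$ (the greedy expansion, $x_i=\lfloor \beta\, T_\beta^{i-1}(x)\rfloor$ with $T_\beta(x)=\beta x \bmod 1$). The one-sided $\beta$-shift is $X_\beta=\overline{d_\beta([0,1))}$ (closure in the product topology). Put $d_\beta^*(1)=\lim_{x\nearrow 1}d_\beta(x)$. Equivalently (Parry), a sequence $x$ over $\{0,\ldots,\lfloor\beta\rfloor\}$ is in $X_\beta$ iff $\sigma^i(x)\preceq d_\beta^*(1)$ for all $i\ge 0$, where $\sigma$ is the left shift and $\preceq$ is lexicographic order. For a shift $X$, $L(X)$ is the set of finite words appearing in points of $X$, and $L_n(X)$ is the set of those of length $n$. The follower set of $w\in L(X)$ is $F_X(w)=\{u\in L(X): wu\in L(X)\}$. For a positive integer $n$, $F_X(n)=\{F_X(w): w\in L_n(X)\}$, so $|F_X(n)|$ is the number of distinct follower sets of words of length $n$. *)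

(* Defs.v *)
From mathcomp Require Import all_boot all_order all_algebra.
From mathcomp Require Import all_classical all_reals all_analysis.

Set Implicit Arguments.
Unset Strict Implicit.
Unset Printing Implicit Defensive.

Import Order.TTheory GRing.Theory Num.Theory.

Local Open Scope classical_set_scope.
Local Open Scope ring_scope.

Section Language.
Context {A : Type}.
Implicit Types (X : set (nat -> A)) (w : seq A) (n : nat).

Definition appears_in w (x : nat -> A) : Prop :=
  exists i : nat, w = mkseq (fun j => x (i + j)%N) (size w).

Definition language X : set (seq A) :=
  [set w | exists2 x, X x & appears_in w x].

Definition language_of_length X n : set (seq A) :=
  [set w | language X w /\ size w = n].

Definition follower_set X w : set (seq A) :=
  [set u | language X (w ++ u)].

Definition follower_sets X n : set (set (seq A)) :=
  [set follower_set X w | w in language_of_length X n].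

End Language.

Section BetaShift.
Context {R : realType}.
Implicit Types beta x : R.

Definition beta_transform beta x : R :=
  beta * x - (Num.floor (beta * x))%:~R.

(* Sequences are indexed from 0: the term of index i is the digit x_{i+1}.
   [Num.truncn] is the floor, as a natural number, of a nonnegative real. *)
Definition greedy_expansion beta x : nat -> nat :=
  fun i => Num.truncn (beta * iter i (beta_transform beta) x).

(* The letters are taken in the discrete space nat.  For beta > 1 all digits
   lie in {0, ..., floor beta}, and the sequences over this finite alphabet
   form a closed subset of nat ^ nat, so the closure is the one taken in the
   full shift over {0, ..., floor beta}. *)
Definition beta_shift beta : set (nat -> nat) :=
  closure ((greedy_expansion beta @` [set x | 0 <= x < 1])
           : set {ptws nat -> nat}).

End BetaShift.

(* Main.v *)
(** A word belongs to the language of the beta-shift iff it is a prefix of the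
    greedy expansion of some x in [0, 1).  The map T sends the points of
    [0, c) whose first digit is a onto [0, 1) cut at beta * c - a: this is
    empty, or all of [0, 1), or [0, T c).  Reading a word of length n letter by
    letter from c = 1, the words that may follow it are thus the prefixes of
    the greedy expansions of the points of [0, T^k 1) for some k <= n, which
    leaves n + 1 possible follower sets. *)
Require Import Defs.
From mathcomp Require Import all_boot all_order all_algebra.
From mathcomp Require Import all_classical all_reals all_analysis.
From mathcomp Require Import lra.

Import Order.TTheory GRing.Theory Num.Theory.

Local Open Scope classical_set_scope.
Local Open Scope ring_scope.

(** Coordinate projections are continuous and singletons of a discrete space are open, so a cylinder
    is a finite intersection of neighbourhoods. *)
Lemma nbhs_ptws_prefix {A : discreteTopologicalType} (x : nat -> A) (n : nat) :
  nbhs (x : {ptws nat -> A}) [set z | forall i, (i < n)%N -> z i = x i].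
Proof.
have nbhsF : Filter (nbhs (x : {ptws nat -> A})) := nbhs_filter _.
elim: n => [|n IHn]; first by apply: filterS filterT => z _ i.
have hn : nbhs (x : {ptws nat -> A}) [set z | z n = x n].
  have xn : nbhs (x n) [set x n] by rewrite nbhs_principalE /=.
  exact: (@proj_continuous nat (fun=> A) n x _ xn).
apply: filterS (filterI IHn hn) => z [/= zx zxn] i.
by rewrite ltnS leq_eqVlt => /orP[/eqP->|/zx].
Qed.

Section GreedyWords.
Context {R : realType}.
Implicit Types beta c x y : R.

Local Notation T := beta_transform.

Definition greedy_prefix beta x (w : seq nat) : Prop :=
  w = mkseq (greedy_expansion beta x) (size w).

Definition greedy_words beta c : set (seq nat) :=
  [set w | exists2 x, 0 <= x < c & greedy_prefix beta x w].

Lemma greedy_expansion_iter beta x i j :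
  greedy_expansion beta (iter i (T beta) x) j =
  greedy_expansion beta x (i + j).
Proof. by rewrite /greedy_expansion -iterD addnC. Qed.

Lemma greedy_prefix_cons beta x a w :
  greedy_prefix beta x (a :: w) <->
  a = Num.truncn (beta * x) /\ greedy_prefix beta (T beta x) w.
Proof.
rewrite /greedy_prefix.
have -> : mkseq (greedy_expansion beta x) (size (a :: w)) =
    Num.truncn (beta * x) :: mkseq (greedy_expansion beta (T beta x)) (size w).
  rewrite /mkseq /= (iotaDl 1 0) -map_comp; congr (_ :: _).
  by apply: eq_map => j; rewrite (greedy_expansion_iter beta x 1).
by split=> [[-> <-]|[-> <-]].
Qed.

Lemma beta_transform_itv beta x : 0 <= T beta x < 1.
Proof.
have := floor_itv (beta * x); rewrite /beta_transform intrD.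
by move=> /andP[h1 h2]; apply/andP; split; lra.
Qed.

Lemma iter_beta_transform_itv beta x i :
  0 <= x < 1 -> 0 <= iter i (T beta) x < 1.
Proof. by case: i => // i _; exact: beta_transform_itv. Qed.

Lemma beta_transform_truncn beta x : 0 <= beta * x ->
  T beta x = beta * x - (Num.truncn (beta * x))%:R.
Proof.
move=> bx0; rewrite /beta_transform; congr (_ - _).
rewrite (@floor_def _ _ (Num.truncn (beta * x) : int)) //.
by have := truncn_itv bx0; rewrite intrD -!pmulrn -natr1.
Qed.

(** The only candidate for [x] is [(y + a) / beta], and for it [x < c] reads [y < beta * c - a]. *)
Lemma beta_transform_image beta c y (a : nat) : 0 < beta ->
  (exists2 x, 0 <= x < c & a = Num.truncn (beta * x) /\ T beta x = y) <->
  0 <= y < 1 /\ y < beta * c - a%:R.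
Proof.
move=> b0; split.
- move=> [x /andP[x0 xc] [-> <-]]; split; first exact: beta_transform_itv.
  rewrite beta_transform_truncn ?mulr_ge0 ?(ltW b0)// ltrD2r.
  by rewrite ltr_pM2l.
- move=> [/andP[y0 y1] yc].
  have bx : beta * ((y + a%:R) / beta) = y + a%:R.
    by rewrite mulrC divfK// gt_eqF.
  have a0 : 0 <= a%:R :> R by [].
  have ya : Num.truncn (y + a%:R) = a.
    by apply: truncn_def; rewrite -natr1; apply/andP; split; lra.
  exists ((y + a%:R) / beta).
    rewrite divr_ge0 ?addr_ge0 ?(ltW b0)//=.
    by rewrite ltr_pdivrMr//; lra.
  rewrite beta_transform_truncn bx ?ya ?addr_ge0//.
  by split=> //; rewrite addrK.
Qed.

Lemma greedy_words_cons beta c a v : 0 < beta ->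
  greedy_words beta c (a :: v) <->
  exists2 y, 0 <= y < 1 /\ y < beta * c - a%:R & greedy_prefix beta y v.
Proof.
move=> b0; split.
- move=> [x xc /greedy_prefix_cons[ax xv]]; exists (T beta x) => //.
  by apply/beta_transform_image => //; exists x.
- move=> [y /beta_transform_image-/(_ b0)[x xc [ax <-]] xv].
  by exists x => //; apply/greedy_prefix_cons.
Qed.

(** That [a :: w] is a word rules out the empty case: some [y >= 0] lies below the cut
    [beta * c - a], which is therefore positive. *)
Lemma greedy_words_behead beta c a w : 0 < beta -> 0 <= c ->
  greedy_words beta c (a :: w) ->
  (forall v, greedy_words beta c (a :: v) <-> greedy_words beta 1 v) \/
  (forall v, greedy_words beta c (a :: v) <-> greedy_words beta (T beta c) v).
Proof.
move=> b0 c0 /(greedy_words_cons _ _ _ _ b0)[y [/andP[y0 y1] yc] _].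
have [c1|c1] := leP 1 (beta * c - a%:R).
- left=> v; split=> [/(greedy_words_cons _ _ _ _ b0)[z [z01 _] zv]|].
    by exists z.
  move=> [z z01 zv]; apply/(greedy_words_cons _ _ _ _ b0); exists z => //.
  by split=> //; case/andP: z01 => _ /lt_le_trans; apply.
(* The cut lies strictly between 0 and 1, so [a] is the first digit of [c] and the cut equals
   [T c]. *)
- have ac : Num.truncn (beta * c) = a.
    by apply: truncn_def; rewrite -natr1; apply/andP; split; lra.
  right=> v; rewrite beta_transform_truncn ?mulr_ge0 ?(ltW b0)// ac.
  split=> [/(greedy_words_cons _ _ _ _ b0)[z [/andP[z0 _] zc] zv]|].
    by exists z => //; rewrite z0.
  move=> [z /andP[z0 zc] zv]; apply/(greedy_words_cons _ _ _ _ b0).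
  by exists z => //; split=> //; rewrite z0 (lt_trans zc).
Qed.

(** Each letter read either resets the index to 0, since [1] is the 0-th iterate, or raises it by
    one; hence the bound [k + size w]. *)
Lemma greedy_words_cat beta w : 0 < beta ->
  forall k, greedy_words beta (iter k (T beta) 1) w ->
  exists2 j, (j <= k + size w)%N &
    forall u, greedy_words beta (iter k (T beta) 1) (w ++ u) <->
              greedy_words beta (iter j (T beta) 1) u.
Proof.
move=> b0; elim: w => [|a w IHw] k wk; first by exists k; rewrite ?addn0.
have c0 : 0 <= iter k (T beta) 1.
  (* The starting point 1 is outside [[0, 1)], so [k = 0] is treated apart. *)
  case: k {wk} => [|k] //=.
  by case/andP: (beta_transform_itv beta (iter k (T beta) 1)).
have [k1|kS] := greedy_words_behead _ _ _ _ b0 c0 wk.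
- have /(IHw 0%N)[j jw ju] : greedy_words beta 1 w by apply/k1.
  exists j => [|u]; last by rewrite cat_cons k1; exact: ju.
  by rewrite (leq_trans jw)// leq_add.
- have /(IHw k.+1)[j jw ju] : greedy_words beta (iter k.+1 (T beta) 1) w.
    by apply/kS.
  exists j => [|u]; last by rewrite cat_cons kS; exact: ju.
  by rewrite /= addnS -addSn.
Qed.

Lemma language_beta_shift beta : language (beta_shift beta) = greedy_words beta 1.
Proof.
apply/seteqP; split=> w.
- move=> [x clx [i wx]].
  (* The occurrence of [w] at [i] involves only the first [i + size w] terms of [x], and some greedy
     expansion shares them; shifting it by [i] amounts to iterating [T]. *)
  have [_ [[y y01 <-] /= xy]] := clx _ (nbhs_ptws_prefix x (i + size w)).
  exists (iter i (T beta) y); first exact: iter_beta_transform_itv.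
  rewrite /greedy_prefix [LHS]wx; apply/eq_in_map => j.
  by rewrite mem_iota /= => jw; rewrite greedy_expansion_iter xy// ltn_add2l.
- move=> [x x01 xw]; exists (greedy_expansion beta x); last by exists 0%N.
  by apply: subset_closure; exists x.
Qed.

End GreedyWords.

Theorem theorem3p5 (R : realType) (beta : R) (n : nat)
    (hbeta : 1 < beta) (hn : (0 < n)%N) :
  (follower_sets (beta_shift beta) n #<= `I_n.+1)%card.
Proof.
have b0 : 0 < beta by exact: lt_trans hbeta.
(* It suffices that the image of [{0, ..., n}] under [G] contains every follower set; reading starts
   at index 0, that is, at [c = 1]. *)
pose G k := greedy_words beta (iter k (beta_transform beta) 1).
apply: card_le_trans (card_image_le G _); apply: subset_card_le.
move=> _ [w [Lw <-] <-]; rewrite language_beta_shift in Lw.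
have [k kn wk] := greedy_words_cat beta w b0 0%N Lw.
exists k => //; apply/seteqP; rewrite /follower_set language_beta_shift.
by split=> u /wk.
Qed.
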